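(* Let $\mathcal{R}M=D\mathcal{C}$ be any U-match decomposition of $D\in\mathbb{K}^{m\times n}$. Then 1. the set of columns of $\mathcal{C}$ contains a basis for every element of $\mathfrak{W}^n_{\mathrm{dom}}$; 2. the set of columns of $\mathcal{R}$ contains a basis for every element of $\mathfrak{W}^m_{\mathrm{cod}}$.
   Context: $\mathbb{K}$ is a field. A (generalized) matching matrix has at most one nonzero entry in each row and each column. A U-match decomposition of $D\in\mathbb{K}^{m\times n}$ is a tuple $(\mathcal{R},M,D,\mathcal{C})$ with $\mathcal{R}M=D\mathcal{C}$, where $M\in\mathbb{K}^{m\times n}$ is a matching matrix and $\mathcal{R}\in\mathbb{K}^{m\times m}$, $\mathcal{C}\in\mathbb{K}^{n\times n}$ are upper unitriangular (upper triangular with ones on the diagonal). $F_p\subseteq\mathbb{K}^n$ ($0\le p\le n$) is the subspace of vectors supported on $\{1,\dots,p\}$; $G_p\subseteq\mathbb{K}^m$ ($0\le p\le m$) is the subspace of vectors supported on $\{1,\dots,p\}$. $D_\bullet F_p=\{Dv: v\in F_p\}$ and $D^\bullet G_p=\{v\in\mathbb{K}^n: Dv\in G_p\}$. $\mathfrak{W}^n_{\mathrm{dom}}$ is the sublattice (closed under sum and intersection, and containing $0$ and $\mathbb{K}^n$) of the lattice of linear subspaces of $\mathbb{K}^n$ generated by all $F_p$ ($0\le p\le n$) and all $D^\bullet G_p$ ($0\le p\le m$). $\mathfrak{W}^m_{\mathrm{cod}}$ is the sublattice of the lattice of linear subspaces of $\mathbb{K}^m$ generated by all $G_p$ ($0\le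 p\le m$) and all $D_\bullet F_p$ ($0\le p\le n$). *)

(* Defs.v *)
From mathcomp Require Import all_boot all_algebra.

Set Implicit Arguments.
Unset Strict Implicit.
Unset Printing Implicit Defensive.

Import GRing.Theory.
Local Open Scope ring_scope.

(* Vectors are column vectors, and indices run over 0, ..., n - 1 instead of
   1, ..., n; "supported on {1, ..., p}" becomes "zero at every i >= p". *)

Definition matching_mx (K : fieldType) (m n : nat) (M : 'M[K]_(m, n)) : Prop :=
  (forall i : 'I_m, (#|[set j : 'I_n | M i j != 0%R]| <= 1)%N) /\
  (forall j : 'I_n, (#|[set i : 'I_m | M i j != 0%R]| <= 1)%N).

(* The library's is_trig_mx means lower triangular. *)
Definition upper_unitriangular (K : fieldType) (n : nat) (A : 'M[K]_n) : Prop :=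
  (forall i j : 'I_n, (j < i)%N -> A i j = 0) /\ (forall i : 'I_n, A i i = 1).

Definition U_match (K : fieldType) (m n : nat)
    (R : 'M[K]_m) (M D : 'M[K]_(m, n)) (C : 'M[K]_n) : Prop :=
  [/\ matching_mx M, upper_unitriangular R, upper_unitriangular C
    & R *m M = D *m C].

Definition std_flag (K : fieldType) (n p : nat) : {vspace 'cV[K]_n} :=
  (\sum_(i < n | (i < p)%N) <[delta_mx i ord0]>)%VS.

Lemma mem_std_flag (K : fieldType) (n p : nat) (v : 'cV[K]_n) :
  reflect (forall i : 'I_n, (p <= i)%N -> v i ord0 = 0) (v \in std_flag K n p).
Proof.
apply: (iffP idP) => [/memv_sumP[w w_in ->] i le_pi | v0].
  rewrite summxE big1 // => j lt_jp.
  have /vlineP[k ->] := w_in j lt_jp; rewrite !mxE.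
  by case: eqP => [eq_ij|_]; rewrite ?mulr0 // -eq_ij ltnNge le_pi in lt_jp *.
have ->: v = \sum_(i < n | (i < p)%N) v i ord0 *: delta_mx i ord0.
  apply/colP=> i; rewrite summxE.
  have [lt_ip | le_pi] := ltnP i p.
    rewrite (bigD1 i) //= !mxE !eqxx mulr1 big1 ?addr0 // => j /andP[_ ne_ji].
    by rewrite !mxE eq_sym (negPf ne_ji) mulr0.
  rewrite [LHS]v0 // big1 // => j lt_jp; rewrite !mxE.
  by case: eqP => [eq_ij|_]; rewrite ?mulr0 // -eq_ij ltnNge le_pi in lt_jp *.
apply: memv_suml => i lt_ip; apply: memvZ.
by rewrite memvE; apply: (sumv_sup i).
Qed.

Definition mx_hom (K : fieldType) (m n : nat) (D : 'M[K]_(m, n)) :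
    'Hom('cV[K]_n, 'cV[K]_m) :=
  linfun (mulmx D).

Lemma mem_mx_preim (K : fieldType) (m n : nat) (D : 'M[K]_(m, n)) V v :
  (v \in mx_hom D @^-1: V)%VS = (D *m v \in V).
Proof. by rewrite -memv_preim lfunE. Qed.

Lemma mem_mx_img (K : fieldType) (m n : nat) (D : 'M[K]_(m, n)) U w :
  (w \in mx_hom D @: U)%VS <-> exists2 v, v \in U & w = D *m v.
Proof.
split=> [/memv_imgP[v Uv ->] | [v Uv ->]]; first by exists v; rewrite // lfunE.
by apply/memv_imgP; exists v; rewrite // lfunE.
Qed.

Inductive gen_sublattice (K : fieldType) (vT : vectType K)
    (gens : {vspace vT} -> Prop) : {vspace vT} -> Prop :=
| gen_sublattice_gen U : gens U -> gen_sublattice gens U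
| gen_sublattice_0 : gen_sublattice gens 0%VS
| gen_sublattice_full : gen_sublattice gens fullv
| gen_sublattice_add U V : gen_sublattice gens U -> gen_sublattice gens V ->
    gen_sublattice gens (U + V)%VS
| gen_sublattice_cap U V : gen_sublattice gens U -> gen_sublattice gens V ->
    gen_sublattice gens (U :&: V)%VS.

Definition W_dom (K : fieldType) (m n : nat) (D : 'M[K]_(m, n)) :
    {vspace 'cV[K]_n} -> Prop :=
  gen_sublattice (fun U =>
    (exists2 p, (p <= n)%N & U = std_flag K n p) \/
    (exists2 p, (p <= m)%N & U = (mx_hom D @^-1: std_flag K m p)%VS)).

Definition W_cod (K : fieldType) (m n : nat) (D : 'M[K]_(m, n)) :
    {vspace 'cV[K]_m} -> Prop :=
  gen_sublattice (fun U =>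
    (exists2 p, (p <= m)%N & U = std_flag K m p) \/
    (exists2 p, (p <= n)%N & U = (mx_hom D @: std_flag K n p)%VS)).

Definition columns_contain_basis (K : fieldType) (m n : nat)
    (A : 'M[K]_(m, n)) (U : {vspace 'cV[K]_m}) : Prop :=
  exists J : {set 'I_n}, basis_of U [seq col j A | j in J].

(* Main.v *)
Require Import Defs.
From mathcomp Require Import all_boot all_algebra.

Local Open Scope ring_scope.

(** Since [R] and [C] are invertible, the subspaces spanned by sets of columns
    of one of them form a sublattice, isomorphic to the lattice of index sets.
    So it suffices to write each generator as the span of a set of columns. By
    triangularity the first [p] columns span the [p]-th standard subspace. In
    the coordinates given by the columns of [C] and [R], the map [D] becomes the
    matching matrix [M], under which preimages and images of coordinate
    subspaces are coordinate subspaces. *)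

Import GRing.Theory.

Set Implicit Arguments.
Unset Strict Implicit.

Section ColumnSpans.

Variables (K : fieldType) (n : nat).
Implicit Types (A : 'M[K]_n) (J : {set 'I_n}) (v : 'cV[K]_n).

Definition col_span A J : {vspace 'cV[K]_n} := (\sum_(j in J) <[col j A]>)%VS.

Lemma mulmx_sum_scale_col m (B : 'M[K]_(m, n)) v :
  B *m v = \sum_j v j ord0 *: col j B.
Proof.
apply/colP=> i; rewrite mxE summxE; apply: eq_bigr => j _.
by rewrite !mxE mulrC.
Qed.

Lemma span_cols A J : <<[seq col j A | j in J]>>%VS = col_span A J.
Proof. by rewrite span_def big_map big_enum. Qed.

Lemma mem_col_col_span A J j : j \in J -> col j A \in col_span A J.
Proof. by move=> Jj; rewrite memvE; apply: (sumv_sup j). Qed.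

Lemma mulmx_col_invmx A j : A \in unitmx -> invmx A *m col j A = delta_mx j ord0.
Proof. by move=> uA; rewrite colE mulKmx. Qed.

(** [invmx A] sends column [j] of [A] to the [j]-th standard vector, so [invmx A *m v] lists the
    coordinates of [v] in the basis of columns. Membership in a span thus becomes a vanishing
    condition on coordinates. *)
Lemma mem_col_span A J v : A \in unitmx ->
  v \in col_span A J <->
  (forall j, j \notin J -> (invmx A *m v) j ord0 = 0).
Proof.
move=> uA; split=> [/memv_sumP[w w_in ->] i notJi | v0].
  rewrite mulmx_sumr summxE big1 // => j Jj.
  have /vlineP[k ->] := w_in j Jj.
  rewrite -scalemxAr mulmx_col_invmx // !mxE.
  by case: eqP => [eq_ij|_]; rewrite ?mulr0 // -eq_ij (negPf notJi) in Jj *.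
rewrite -[v](mulKVmx uA) mulmx_sum_scale_col.
apply: memv_suml => j _; case: (boolP (j \in J)) => [Jj | /v0 ->].
  by apply/memvZ/mem_col_col_span.
by rewrite scale0r mem0v.
Qed.

Lemma free_cols A J : A \in unitmx -> free [seq col j A | j in J].
Proof.
move=> uA; have free_all: free [seq col j A | j : 'I_n].
  have span_all: <<[seq col j A | j : 'I_n]>>%VS = fullv.
    apply/vspaceP=> v; rewrite memvf span_def big_map big_enum /=.
    rewrite -[v](mulKVmx uA) mulmx_sum_scale_col.
    apply: memv_suml => j _; apply: memvZ.
    by rewrite memvE; apply: (sumv_sup j).
  by rewrite /free span_all dimvf dim_matrix size_map -cardE card_ord mulr1.
(* Listing [J] first and its complement second makes the chosen columns a prefix of a permutation of
   the free family of all columns. *)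
have: perm_eq [seq col j A | j <- enum J ++ enum (~: J)]
              [seq col j A | j : 'I_n].
  apply: perm_map; apply: uniq_perm => [||j]; last 1 first.
  - by rewrite mem_cat !mem_enum inE orbN.
  - rewrite cat_uniq !enum_uniq andbT; apply/hasPn=> j.
    by rewrite !mem_enum inE.
  - exact: enum_uniq.
by move/perm_free; rewrite free_all map_cat => /catl_free.
Qed.

Lemma dim_col_span A J : A \in unitmx -> \dim (col_span A J) = #|J|.
Proof.
move=> uA; rewrite -span_cols; have:= free_cols J uA.
by rewrite /free => /eqP->; rewrite size_map -cardE.
Qed.

Lemma columns_contain_basis_col_span A J :
  A \in unitmx -> columns_contain_basis A (col_span A J).
Proof. by move=> uA; exists J; rewrite /basis_of span_cols eqxx free_cols. Qed.

(** Induction on the generation of [U]: sums correspond to unions of index sets, and intersections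
    to intersections because coordinates in the columns of [A] are unique. *)
Lemma gen_sublattice_col_span A (gens : {vspace 'cV[K]_n} -> Prop) U :
    A \in unitmx -> (forall V, gens V -> exists J, V = col_span A J) ->
  gen_sublattice gens U -> exists J, U = col_span A J.
Proof.
move=> uA gensA; elim=> {U} [U /gensA //||| U V _ [I ->] _ [J ->]
  | U V _ [I ->] _ [J ->]].
- by exists set0; rewrite /col_span big_set0.
- exists setT; apply/vspaceP=> v; rewrite memvf; apply/esym/mem_col_span => //.
  by move=> j; rewrite inE.
- exists (I :|: J); apply/eqP; rewrite eqEsubv; apply/andP; split.
    by rewrite subv_add; apply/andP; split; apply/subv_sumP=> j ?;
      rewrite -memvE mem_col_col_span // inE; apply/orP; [left | right].
  apply/subv_sumP=> j; rewrite inE -memvE.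
  case/orP=> /(mem_col_col_span A); first exact/subvP/addvSl.
  exact/subvP/addvSr.
- exists (I :&: J); apply/vspaceP=> v; rewrite memv_cap; apply/andP/idP.
    case=> /(mem_col_span _ _ uA) vI /(mem_col_span _ _ uA) vJ.
    apply/mem_col_span => // j; rewrite inE negb_and.
    by case/orP=> [/vI | /vJ].
  move=> /(mem_col_span _ _ uA) vIJ.
  by split; apply/mem_col_span => // j notj; apply: vIJ;
     rewrite inE negb_and notj ?orbT.
Qed.

Lemma upper_unitriangular_unitmx A : upper_unitriangular A -> A \in unitmx.
Proof.
case=> A0 A1; rewrite unitmxE -det_tr det_trig.
  by rewrite big1 ?unitr1 // => i _; rewrite mxE.
by apply/is_trig_mxP=> i j lt_ij; rewrite mxE A0.
Qed.

(** Triangularity puts the first columns inside the flag subspace, and equality follows by comparing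
    dimensions. *)
Lemma std_flag_col_span A p : upper_unitriangular A ->
  std_flag K n p = col_span A [set j : 'I_n | (j < p)%N].
Proof.
move=> triA; have uA := upper_unitriangular_unitmx triA.
(* As a span of columns of the identity, the flag has its dimension given by [dim_col_span]. *)
have ->: std_flag K n p = col_span 1%:M [set j : 'I_n | (j < p)%N].
  apply: eq_big => [j | j _]; first by rewrite inE.
  by rewrite colE mul1mx.
apply/esym/eqP; rewrite eqEdim !dim_col_span ?unitmx1 // leqnn andbT.
apply/subv_sumP=> j; rewrite inE -memvE => lt_jp.
apply/mem_col_span; first exact: unitmx1.
move=> i; rewrite inE -leqNgt invmx1 mul1mx mxE => le_pi.
by rewrite triA.1 // (leq_trans lt_jp).
Qed.

End ColumnSpans.

Lemma card_le1_inj (T : finType) (A : {set T}) x y :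
  (#|A| <= 1)%N -> x \in A -> y \in A -> x = y.
Proof. by move/card_le1_eqP=> inA Ax Ay; apply: inA. Qed.

Section UMatch.

Variables (K : fieldType) (m n : nat).
Variables (R : 'M[K]_m) (M D : 'M[K]_(m, n)) (C : 'M[K]_n).
Hypothesis RMDC : U_match R M D C.

(** In the column bases of [C] and [R], the map [D] acts as [M]. *)
Lemma U_match_invmx (v : 'cV[K]_n) :
  invmx R *m (D *m v) = M *m (invmx C *m v).
Proof.
case: RMDC => _ /upper_unitriangular_unitmx uR /upper_unitriangular_unitmx uC e.
by rewrite -{1}[v](mulKVmx uC) !mulmxA -(mulmxA _ D) -e mulKmx.
Qed.

Lemma preim_std_flag_col_span p :
  (mx_hom D @^-1: std_flag K m p)%VS =
  col_span C [set j | [forall (i : 'I_m | (p <= i)%N), M i j == 0]].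
Proof.
case: RMDC => [[rowM _] triR /upper_unitriangular_unitmx uC _].
have uR := upper_unitriangular_unitmx triR.
apply/vspaceP=> v; rewrite mem_mx_preim (std_flag_col_span p triR).
apply/idP/idP=> /mem_col_span v0; apply/mem_col_span => //.
  move=> j; rewrite inE => /forall_inPn[i le_pi Mij].
  have:= v0 uR i; rewrite inE -leqNgt => /(_ le_pi).
  rewrite U_match_invmx mxE (bigD1 j) //= big1 ?addr0.
    by move/eqP; rewrite mulf_eq0 (negPf Mij) => /eqP.
  (* Row [i] of [M] has no nonzero entry besides [M i j], so coordinate [i] of [D *m v] is [M i j]
     times coordinate [j] of [v]. *)
  move=> k /eqP ne_kj; apply/eqP; rewrite mulf_eq0; apply/orP; left.
  apply/eqP; case: (M i k =P 0) => // /eqP Mik; case: ne_kj.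
  by apply: card_le1_inj (rowM i) _ _; rewrite inE.
move=> i; rewrite inE -leqNgt U_match_invmx mxE => le_pi.
(* A nonzero [M i j] with [p <= i] excludes [j] from the index set, so coordinate [j] of [v]
   vanishes. *)
apply: big1 => j _; case: (M i j =P 0) => [-> | /eqP Mij]; first by rewrite mul0r.
rewrite (v0 uC) ?mulr0 // inE; by apply/forall_inPn; exists i.
Qed.

Lemma img_std_flag_col_span p :
  (mx_hom D @: std_flag K n p)%VS =
  col_span R [set i | [exists (j : 'I_n | (j < p)%N), M i j != 0]].
Proof.
case: RMDC => [[_ colM] /upper_unitriangular_unitmx uR triC e].
have uC := upper_unitriangular_unitmx triC.
rewrite (std_flag_col_span p triC); apply/eqP; rewrite eqEsubv; apply/andP; split.
  apply/subvP=> w /mem_mx_img[v /mem_col_span v0 ->].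
  apply/mem_col_span => // i; rewrite inE => /exists_inPn Mi0.
  rewrite U_match_invmx mxE big1 // => j _.
  case: (ltnP j p) => [/Mi0 | le_pj]; first by rewrite negbK => /eqP->; rewrite mul0r.
  by rewrite v0 ?mulr0 // inE -leqNgt.
apply/subv_sumP=> i; rewrite inE -memvE => /exists_inP[j lt_jp Mij].
(* The only nonzero entry of column [j] of [M] is [M i j], so [D *m col j C = R *m col j M = M i j
   *: col i R]; the scalar undoes this factor. *)
apply/mem_mx_img; exists ((M i j)^-1 *: col j C).
  by apply/memvZ/mem_col_col_span; rewrite inE.
have colMj: col j M = M i j *: delta_mx i ord0.
  apply/colP=> k; rewrite !mxE andbT; case: eqP => [-> | ne_ki].
    by rewrite mulr1.
  rewrite mulr0; case: (M k j =P 0) => // /eqP Mkj; case: ne_ki.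
  by apply: card_le1_inj (colM j) _ _; rewrite inE.
rewrite -scalemxAr [col j C]colE mulmxA -e -mulmxA -colE colMj -scalemxAr -colE.
by rewrite scalerA mulVf // scale1r.
Qed.

End UMatch.

Theorem mainTheorem7 (K : fieldType) (m n : nat)
    (R : 'M[K]_m) (M D : 'M[K]_(m, n)) (C : 'M[K]_n) :
  U_match R M D C ->
  (forall U : {vspace 'cV[K]_n}, W_dom D U -> columns_contain_basis C U) /\
  (forall U : {vspace 'cV[K]_m}, W_cod D U -> columns_contain_basis R U).
Proof.
move=> RMDC; have [_ triR triC _] := RMDC.
have uR := upper_unitriangular_unitmx triR.
have uC := upper_unitriangular_unitmx triC.
split=> U.
  case/(gen_sublattice_col_span uC) => [V [] [p _ ->] | J ->].
  - by eexists; apply: std_flag_col_span.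
  - by eexists; apply: (preim_std_flag_col_span RMDC).
  - exact: columns_contain_basis_col_span.
case/(gen_sublattice_col_span uR) => [V [] [p _ ->] | J ->].
- by eexists; apply: std_flag_col_span.
- by eexists; apply: (img_std_flag_col_span RMDC).
- exact: columns_contain_basis_col_span.
Qed.
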